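(* Let $S$ be a straight left I-order in an inverse semigroup $Q$ and let $\phi:S\to P$ be an embedding of $S$ into an inverse semigroup $P$ such that $S\phi$ is a straight left I-order in $P$. Then $Q$ is isomorphic to $P$ over $S$ (that is, $\phi$ lifts to an isomorphism $Q\to P$) if and only if for any $a,b,c\in S$: (i) $(a,b)\in\mathcal{R}^Q_S\Leftrightarrow (a\phi,b\phi)\in\mathcal{R}^P_{S\phi}$; and (ii) $(a,b,c)\in\mathcal{T}^Q_S\Leftrightarrow (a\phi,b\phi,c\phi)\in\mathcal{T}^P_{S\phi}$.
   Context: Maps are written on the right. For $a$ in an inverse semigroup, $a^{-1}$ is its inverse in the sense of inverse semigroup theory. A subsemigroup $S$ of an inverse semigroup $Q$ is a left I-order in $Q$ if every $q\in Q$ can be written as $q=a^{-1}b$ with $a,b\in S$; it is straight in $Q$ if every $q\in Q$ can be written as $q=a^{-1}b$ with $a,b\in S$ and $a\,\mathcal{R}\,b$ in $Q$ (Green's relation). For a subsemigroup $S$ of an inverse semigroup $Q$: $\mathcal{R}^Q_S=\mathcal{R}^Q\cap(S\times S)$, where $\mathcal{R}^Q$ is Green's relation $\mathcal{R}$ on $Q$; and $\mathcal{T}^Q_S$ is the ternary relation on $S$ given by $(a,b,c)\in\mathcal{T}^Q_S$ if and only if $ab^{-1}Q\subseteq c^{-1}Q$ (inverses taken in $Q$). Similarly $\mathcal{R}^P_{S\phi}$, $\mathcal{T}^P_{S\phi}$ for $S\phi\subseteq P$. The morphism $\phi:S\to P$ lifts to $\overline\phi:Q\to P$ if $\overline\phi$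 is a morphism with $\overline\phi|_S=\phi$. *)

(* Defs.v *)
From HB Require Import structures.
From mathcomp Require Import all_boot.
From mathcomp Require Import classical_sets.

Set Implicit Arguments.
Unset Strict Implicit.
Unset Printing Implicit Defensive.

Local Open Scope group_scope.
Local Open Scope classical_set_scope.

(* The library's x^-1 is tied to structures with a unit, so the inverse of an
   inverse semigroup is a separate operation, sginv. *)
HB.mixin Record Semigroup_isInverse G of Semigroup G := {
  sginv : G -> G;
  mulgVK_sg : forall x : G, x * sginv x * x = x;
  mulVgK_sg : forall x : G, sginv x * x * sginv x = sginv x;
  sginv_uniq : forall x y : G, x * y * x = x -> y * x * y = y -> y = sginv x
}.

#[short(type="inverseSemigroupType")]
HB.structure Definition InverseSemigroup :=
  {G of Semigroup G & Semigroup_isInverse G}.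

Bind Scope group_scope with InverseSemigroup.sort.

Section InverseSemigroupTheory.

Variable Q : inverseSemigroupType.
Implicit Types (a b c q : Q) (S : set Q).

(* a Q *)
Definition right_translates a : set Q := [set a * x | x in [set: Q]].

(* a Q^1, where Q^1 is Q with a unit adjoined if it has none *)
Definition principal_right_ideal a : set Q := a |` right_translates a.

Definition green_R a b := principal_right_ideal a = principal_right_ideal b.

Definition subsemigroup S := forall a b, S a -> S b -> S (a * b).

Definition left_I_order S :=
  subsemigroup S /\ forall q, exists a b, [/\ S a, S b & q = sginv a * b].

Definition straight S :=
  forall q, exists a b, [/\ S a, S b, green_R a b & q = sginv a * b].

Definition straight_left_I_order S := left_I_order S /\ straight S.

Definition green_R_on S a b := [/\ S a, S b & green_R a b].

(* a b^-1 Q `<=` c^-1 Q, for a, b, c in S *)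
Definition ternary_T_on S a b c :=
  [/\ S a, S b, S c &
      right_translates (a * sginv b) `<=` right_translates (sginv c)].

End InverseSemigroupTheory.

Definition lifts (Q P : inverseSemigroupType) (A : pred Q)
    (S : subSemigroupType A) (phi : S -> P) (psi : Q -> P) :=
  forall s : S, psi (val s) = phi s.

Definition isomorphic_over (Q P : inverseSemigroupType) (A : pred Q)
    (S : subSemigroupType A) (phi : S -> P) :=
  exists psi : {multiplicative Q -> P}, bijective psi /\ lifts phi psi.

(* Main.v *)
Require Import Defs.
From HB Require Import structures.
From mathcomp Require Import all_boot.
From mathcomp Require Import boolp classical_sets.

(** Write x^v for the inverse of x.  An isomorphism over S must send a fraction
    a^v b to (phi a)^v (phi b), and straightness makes every element of Q and of
    P such a fraction with a R b; so the question is whether equality and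
    products of straight fractions can be computed in S from R and T alone.

    Both reduce to the elements b c^v, with b and c in S.  If x R y, then
    [fraction_eq] says that b c^v = x^v y holds exactly when x b = y c,
    y R y c and b c^v Q is contained in x^v Q.  The first condition lives in S,
    the second is an instance of R and the third of T.  Hence the relation
    b c^v = x^v y passes from Q to P ([transfer_fraction]).

    - Products: if b c^v = x^v y, then (a^v b)(c^v d) = (x a)^v (y d), again a
      straight fraction ([fraction_mul_R]).

    - Equality: a^v b = c^v d with a R b and c R d means that a L c, b L d and
      c a^v = d b^v.  The last equation passes to P by naming a fraction x^v y
      equal to both sides; the L relations pass because c a^v a = c can be
      written with the same x and y, using T once more ([transfer_le_L]).

    So (a^v b, (phi a)^v (phi b)) ranges over the graph of a multiplicative map
    from Q to P.  The hypotheses are symmetric in Q and P, so the converse graph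
    is a map too, and the map is an isomorphism.  Conversely an isomorphism
    preserves R and T because both are equations between products and
    inverses. *)

Set Implicit Arguments.
Unset Strict Implicit.
Unset Printing Implicit Defensive.

Local Open Scope group_scope.
Local Open Scope classical_set_scope.

Local Notation "x ^v" := (sginv x) (at level 2, format "x ^v").

(** * Idempotents and Green's relation R in an inverse semigroup *)

Section InverseSemigroup.

Variable Q : inverseSemigroupType.
Implicit Types a b c d e q x y z : Q.

Lemma sginvK x : x^v^v = x.
Proof. by apply/esym/sginv_uniq; rewrite ?mulgVK_sg ?mulVgK_sg. Qed.

Lemma sginv_idem e : e * e = e -> e^v = e.
Proof. by move=> ee; apply/esym/sginv_uniq; rewrite !ee. Qed.

(** The element e (d e)^v d is again an inverse of d e, so it is (d e)^v; written
    in this way, (d e)^v is visibly idempotent, and then so is its inverse d e. *)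
Lemma mul_idem d e : d * d = d -> e * e = e -> d * e * (d * e) = d * e.
Proof.
move=> dd ee; set x := (d * e)^v.
have xE : e * x * d = x.
  apply: sginv_uniq.
    rewrite !mulgA -(mulgA d e e) ee -(mulgA _ d d) dd.
    by rewrite -!mulgA (mulgA d e) !mulgA -(mulgA _ d e) mulgVK_sg.
  rewrite -!mulgA (mulgA d d) dd (mulgA e e) ee.
  by rewrite (mulgA d e) (mulgA x (d * e)) (mulgA (x * _) x) mulVgK_sg.
have xx : x * x = x.
  rewrite -{1 2}xE -!mulgA (mulgA d e) (mulgA x (d * e)) (mulgA (x * _) x).
  by rewrite mulVgK_sg mulgA.
by rewrite -(sginvK (d * e)) -/x (sginv_idem xx).
Qed.

(** Since d e and e d are both idempotent, each is the inverse of the other, while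
    an idempotent is its own inverse. *)
Lemma idemC d e : d * d = d -> e * e = e -> d * e = e * d.
Proof.
move=> dd ee; rewrite -(sginv_idem (mul_idem ee dd)).
have de := mul_idem dd ee; have ed := mul_idem ee dd.
apply: sginv_uniq.
  by rewrite -!mulgA (mulgA d d) dd (mulgA e e) ee mulgA ed.
by rewrite -!mulgA (mulgA d d) dd (mulgA e e) ee mulgA de.
Qed.

Lemma mulgV_idem x : x * x^v * (x * x^v) = x * x^v.
Proof. by rewrite mulgA mulgVK_sg. Qed.

Lemma mulVg_idem x : x^v * x * (x^v * x) = x^v * x.
Proof. by rewrite mulgA mulVgK_sg. Qed.

Lemma sginvM x y : (x * y)^v = y^v * x^v.
Proof.
have C := idemC (mulgV_idem y) (mulVg_idem x).
apply/esym/sginv_uniq.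
  rewrite !mulgA -(mulgA x y) -(mulgA x _ x^v) -(mulgA x _ x) -(mulgA _ x^v x).
  by rewrite C !mulgA mulgVK_sg -!mulgA (mulgA y) mulgVK_sg.
rewrite !mulgA -(mulgA y^v x^v) -(mulgA y^v _ y) -(mulgA y^v _ y^v).
rewrite -(mulgA _ y y^v) -C !mulgA mulVgK_sg.
by rewrite -!mulgA (mulgA x^v) mulVgK_sg.
Qed.

(** Inclusion of right translates is an equation because x x^v is an idempotent
    that generates the same right ideal as x. *)
Lemma sub_right_translates x y :
  right_translates x `<=` right_translates y <-> y * y^v * x = x.
Proof.
split=> [sxy|yx _ [z _ <-]]; last first.
  by exists (y^v * x * z) => //; rewrite !mulgA yx.
have [|z _ <-] := sxy x; first by exists (x^v * x) => //; rewrite mulgA mulgVK_sg.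
by rewrite mulgA mulgVK_sg.
Qed.

Lemma sub_right_translates_inv x c :
  right_translates x `<=` right_translates c^v <-> c^v * c * x = x.
Proof. by rewrite sub_right_translates sginvK. Qed.

Lemma principal_right_idealE a : principal_right_ideal a = right_translates a.
Proof.
rewrite /principal_right_ideal; apply/setUidPr => _ ->.
by exists (a^v * a) => //; rewrite mulgA mulgVK_sg.
Qed.

Lemma green_RE a b : green_R a b <-> a * a^v = b * b^v.
Proof.
rewrite /green_R !principal_right_idealE; split=> [ab|ab].
  have /sub_right_translates ba : right_translates a `<=` right_translates b.
    by rewrite ab.
  have /sub_right_translates ab' : right_translates b `<=` right_translates a.
    by rewrite ab.
  rewrite -{1}ba -(mulgA _ a) [LHS]idemC; [|exact: mulgV_idem|exact: mulgV_idem].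
  by rewrite mulgA ab'.
by apply/seteqP; split; apply/sub_right_translates;
  rewrite ?ab ?mulgVK_sg // -ab mulgVK_sg.
Qed.

(** In the sandwich y (c c^v) y^v = y y^v the right factor y^v cancels: multiply
    by y on the right and commute c c^v with y^v y. *)
Lemma green_R_mulr y c : green_R y (y * c) <-> y * c * c^v = y.
Proof.
rewrite green_RE sginvM !mulgA; split=> [yE|->//].
rewrite -{1}(mulgVK_sg y) -!mulgA (mulgA y^v y).
rewrite (idemC (mulVg_idem y) (mulgV_idem c)).
by rewrite !mulgA -yE mulgVK_sg.
Qed.

(** * Straight fractions *)

Lemma fraction_flip x y b c : b * c^v = x^v * y -> c * b^v = y^v * x.
Proof. by move=> E; rewrite -[c]sginvK -sginvM E sginvM sginvK. Qed.

Lemma fraction_canc x y b c : green_R x y -> b * c^v = x^v * y ->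
  x * b * c^v = y /\ y * c * c^v = y.
Proof.
move=> /green_RE xy E.
have Ey : x * b * c^v = y by rewrite -mulgA E mulgA xy mulgVK_sg.
by split=> //; rewrite -{1}Ey -!mulgA (mulgA c^v) mulVgK_sg mulgA.
Qed.

(** The key to the theorem: each condition on the right can be expressed in a
    subsemigroup containing x, y, b, c by its product and the relations R and
    T.  For the direct implication, y = x b c^v and, on taking inverses,
    x = y c b^v; so x b and y c are each obtained from the other by an idempotent
    right factor, and commuting idempotents makes them equal. *)
Lemma fraction_eq x y b c : green_R x y ->
  b * c^v = x^v * y <->
  [/\ x * b = y * c, green_R y (y * c) & x^v * x * (b * c^v) = b * c^v].
Proof.
move=> xy; split=> [E|[xb /green_R_mulr yc <-]]; last first.
  by rewrite -mulgA (mulgA x) xb yc.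
have [Ey yc] := fraction_canc xy E.
have [Ex _] := fraction_canc (esym xy) (fraction_flip E).
split; [|exact/green_R_mulr|by rewrite E !mulgA mulVgK_sg].
(* The sides become y c (b^v b) and y c (b^v b) (c^v c), and c absorbs c^v c. *)
rewrite -[X in X * b = _]Ex -[X in _ = X * c]Ey -[X in _ = X * b * _ * _]Ex.
rewrite -(mulgA _ c^v c) -(mulgA _ b^v b) -(mulgA (y * c) _ (c^v * c)).
by rewrite (idemC (mulVg_idem b) (mulVg_idem c)) !mulgA yc.
Qed.

(** Multiplying the fractions a^v b and c^v d gives a^v x^v y d; this lemma makes
    the result straight, all of x a, x, y and y d being R-related. *)
Lemma fraction_mul_R a b c d x y : green_R a b -> green_R c d ->
  green_R x y -> b * c^v = x^v * y -> green_R (x * a) (y * d).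
Proof.
move=> /green_RE ab /green_RE cd xy E.
have [_ yc] := fraction_canc xy E.
have [_ xb] := fraction_canc (esym xy) (fraction_flip E).
have xa : green_R x (x * a) by apply/green_R_mulr; rewrite -mulgA ab mulgA.
have yd : green_R y (y * d) by apply/green_R_mulr; rewrite -mulgA -cd mulgA.
exact: etrans (esym xa) (etrans xy yd).
Qed.

(** If q = a^v b with a R b, then q q^v = a^v a depends only on q. *)
Lemma fraction_L a b c d : green_R a b -> green_R c d ->
  a^v * b = c^v * d -> a^v * a = c^v * c.
Proof.
have ran x y : green_R x y -> x^v * x = x^v * y * (x^v * y)^v.
  move=> /green_RE xy; rewrite sginvM sginvK -!mulgA (mulgA y) -xy.
  by rewrite !mulgA mulVgK_sg.
by move=> ab cd E; rewrite (ran _ _ ab) E -ran.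
Qed.

End InverseSemigroup.

(** * Transfer of fractions between two inverse semigroups *)

Definition same_RT (S : Type) (Q P : inverseSemigroupType)
    (f : S -> Q) (g : S -> P) :=
  (forall a b, green_R (f a) (f b) <-> green_R (g a) (g b)) /\
  (forall a b c,
     right_translates (f a * (f b)^v) `<=` right_translates (f c)^v <->
     right_translates (g a * (g b)^v) `<=` right_translates (g c)^v).

(** The graph of the only candidate for a morphism carrying f to g. *)
Definition fraction_rel (S : Type) (Q P : inverseSemigroupType)
    (f : S -> Q) (g : S -> P) q p :=
  exists a b,
    [/\ green_R (f a) (f b), q = (f a)^v * f b & p = (g a)^v * g b].

Lemma same_RT_sym (S : Type) (Q P : inverseSemigroupType)
  (f : S -> Q) (g : S -> P) : same_RT f g -> same_RT g f.
Proof. by case=> hR hT; split=> *; apply: iff_sym. Qed.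

Lemma same_RT_onE (S : Type) (Q P : inverseSemigroupType)
    (f : S -> Q) (g : S -> P) :
  (forall a b c,
    (green_R_on (range f) (f a) (f b) <-> green_R_on (range g) (g a) (g b)) /\
    (ternary_T_on (range f) (f a) (f b) (f c) <->
       ternary_T_on (range g) (g a) (g b) (g c))) <-> same_RT f g.
Proof.
have Sf a : range f (f a) by exists a.
have Sg a : range g (g a) by exists a.
split=> [RT|[hR hT] a b c]; last first.
  split; split=> -[].
  - by move=> _ _ /hR h; exact: (And3 (Sg a) (Sg b) h).
  - by move=> _ _ /hR h; exact: (And3 (Sf a) (Sf b) h).
  - by move=> _ _ _ /hT h; exact: (And4 (Sg a) (Sg b) (Sg c) h).
  - by move=> _ _ _ /hT h; exact: (And4 (Sf a) (Sf b) (Sf c) h).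
split=> [a b|a b c].
  have [[h1 h2] _] := RT a b a; split=> h.
    by have [] := h1 (And3 (Sf a) (Sf b) h).
  by have [] := h2 (And3 (Sg a) (Sg b) h).
have [_ [h1 h2]] := RT a b c; split=> h.
  by have [] := h1 (And4 (Sf a) (Sf b) (Sf c) h).
by have [] := h2 (And4 (Sg a) (Sg b) (Sg c) h).
Qed.

Lemma fraction_rel_sym (S : Type) (Q P : inverseSemigroupType)
  (f : S -> Q) (g : S -> P) q p :
  same_RT f g -> fraction_rel f g q p -> fraction_rel g f p q.
Proof. by case=> hR _ [a [b [ab -> ->]]]; exists a, b; split=> //; apply/hR. Qed.

Lemma straight_fractions (S : Type) (Q : inverseSemigroupType) (f : S -> Q) :
  straight (range f) ->
  forall q, exists a b, green_R (f a) (f b) /\ q = (f a)^v * f b.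
Proof.
by move=> st q; have [_ [_ [[a _ <-] [b _ <-] ? ->]]] := st q; exists a, b.
Qed.

Section Lifting.

Variables (S : semigroupType) (Q P : inverseSemigroupType).
Variables (f : {multiplicative S -> Q}) (g : {multiplicative S -> P}).
Hypotheses (f_inj : injective f) (f_straight : straight (range f)).
Hypothesis fg : same_RT f g.

Let fracf := straight_fractions f_straight.

Lemma transfer_fraction x y b c : green_R (f x) (f y) ->
  f b * (f c)^v = (f x)^v * f y -> g b * (g c)^v = (g x)^v * g y.
Proof.
case: fg => hR hT xy /(fraction_eq _ _ xy)[E yc T].
apply/fraction_eq; first exact/hR; split.
- by rewrite -!gmulfM; congr (g _); apply: f_inj; rewrite !gmulfM.
- by rewrite -gmulfM; apply/hR; rewrite gmulfM.
- exact/sub_right_translates_inv/hT/sub_right_translates_inv.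
Qed.

Lemma transfer_quotient a b c d :
  f a * (f b)^v = f c * (f d)^v -> g a * (g b)^v = g c * (g d)^v.
Proof.
move=> E; have [x [y [xy Ex]]] := fracf (f a * (f b)^v).
rewrite (@transfer_fraction x y a b) // (@transfer_fraction x y c d) //.
by rewrite -E.
Qed.

(** The equation c a^v a = c says that c lies below a in the order of L-classes,
    which is not an instance of R or T.  With c a^v = x^v y it amounts to
    x c = y a together with c c^v Q contained in x^v Q, which is an instance of
    T with c in the first two places. *)
Lemma transfer_le_L a c :
  f c * (f a)^v * f a = f c -> g c * (g a)^v * g a = g c.
Proof.
move=> ca; have [x [y [xy Ex]]] := fracf (f c * (f a)^v).
have xc : (f x)^v * f x * (f c * (f c)^v) = f c * (f c)^v.
  by rewrite -{1}ca Ex !mulgA mulVgK_sg -Ex ca.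
have Egx := transfer_fraction xy Ex.
have [E _ _] := (fraction_eq _ _ xy).1 Ex.
have Eg : g x * g c = g y * g a.
  by rewrite -!gmulfM; congr (g _); apply: f_inj; rewrite !gmulfM.
have /sub_right_translates_inv/(fg.2 _ _ _)/sub_right_translates_inv gxc := xc.
rewrite Egx -mulgA -Eg mulgA -[in LHS](mulgVK_sg (g c)) !mulgA.
by move: gxc; rewrite !mulgA => ->; rewrite mulgVK_sg.
Qed.

(** In any inverse semigroup a^v b = c^v d follows from c a^v = d b^v and the L
    relations: a^v b = c^v c a^v b = c^v d b^v b = c^v d. *)
Lemma fraction_rel_fun q p p' :
  fraction_rel f g q p -> fraction_rel f g q p' -> p = p'.
Proof.
move=> [a [b [ab -> ->]]] [c [d [cd E ->]]].
have /green_RE abE := ab; have /green_RE cdE := cd.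
have aLc := fraction_L ab cd E.
have bLd : (f b)^v * f b = (f d)^v * f d.
  apply: (fraction_L (esym ab) (esym cd)).
  by rewrite -{1}(sginvK (f a)) -sginvM E sginvM sginvK.
have ac : g a * (g c)^v * g c = g a.
  by apply: transfer_le_L; rewrite -mulgA -aLc mulgA mulgVK_sg.
have db : g d * (g b)^v * g b = g d.
  by apply: transfer_le_L; rewrite -mulgA bLd mulgA mulgVK_sg.
have cadb : g c * (g a)^v = g d * (g b)^v.
  apply: transfer_quotient.
  rewrite -[f d](mulgVK_sg) -cdE -(mulgA (f c)) -E -!mulgA -abE !mulgA.
  by rewrite -(mulgA (f c)) -(mulgA (f c)) mulVgK_sg.
by rewrite -ac -mulgA sginvM sginvM sginvK -!mulgA (mulgA (g c)) cadb db.
Qed.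

Lemma fraction_relM q q' p p' :
  fraction_rel f g q p -> fraction_rel f g q' p' ->
  fraction_rel f g (q * q') (p * p').
Proof.
move=> [a [b [ab -> ->]]] [c [d [cd -> ->]]].
have [x [y [xy E]]] := fracf (f b * (f c)^v).
exists (x * a), (y * d); rewrite !gmulfM !sginvM; split.
- exact: fraction_mul_R ab cd xy E.
- by rewrite -!mulgA (mulgA (f b)) E !mulgA.
- by rewrite -!mulgA (mulgA (g b)) (transfer_fraction xy E) !mulgA.
Qed.

Lemma fraction_rel_total q : exists p, fraction_rel f g q p.
Proof. by have [a [b [ab ->]]] := fracf q; exists ((g a)^v * g b), a, b. Qed.

Lemma fraction_rel_lifts s : fraction_rel f g (f s) (g s).
Proof.
have [a [b [ab E]]] := fracf (f s); exists a, b; split=> //.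
have /green_RE abE := ab.
(* Straightness of s = a^v b gives a s = a a^v b = b b^v b = b. *)
have asb : a * s = b.
  by apply: f_inj; rewrite gmulfM E mulgA abE mulgVK_sg.
have sa : (f a)^v * f a * (f s * (f s)^v) = f s * (f s)^v.
  by rewrite E !mulgA mulVgK_sg.
have /sub_right_translates_inv/(fg.2 _ _ _)/sub_right_translates_inv ga := sa.
rewrite -asb gmulfM -{1}(mulgVK_sg (g s)) -ga.
by rewrite -!mulgA (mulgA (g s)) mulgVK_sg.
Qed.

End Lifting.

(** * Lifting to an isomorphism *)

Lemma iso_of_same_RT (S : semigroupType) (Q P : inverseSemigroupType)
  (f : {multiplicative S -> Q}) (g : {multiplicative S -> P}) :
  injective f -> straight (range f) -> injective g -> straight (range g) ->
  same_RT f g ->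
  exists psi : {multiplicative Q -> P}, bijective psi /\ psi \o f =1 g.
Proof.
move=> f_inj f_st g_inj g_st fg; have gf := same_RT_sym fg.
have [psi psiP] := choice (@fraction_rel_total _ _ _ f g f_st).
have [chi chiP] := choice (@fraction_rel_total _ _ _ g f g_st).
have psi_uniq q p : fraction_rel f g q p -> psi q = p.
  exact: fraction_rel_fun (psiP q).
have chi_uniq p q : fraction_rel g f p q -> chi p = q.
  exact: fraction_rel_fun (chiP p).
have psiM : {morph psi : x y / x * y}.
  by move=> x y; apply: psi_uniq; apply: fraction_relM.
pose psim : {multiplicative Q -> P} := HB.pack psi
  (isMultiplicative.Build Q P psi psiM).
exists psim; split; last by move=> s; apply/psi_uniq/fraction_rel_lifts.
exists chi => [q|p]; first exact/chi_uniq/fraction_rel_sym.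
exact/psi_uniq/fraction_rel_sym.
Qed.

Lemma morph_sginv (Q P : inverseSemigroupType) (psi : {multiplicative Q -> P}) :
  {morph psi : x / x^v}.
Proof.
by move=> x; apply: sginv_uniq; rewrite -!gmulfM ?mulgVK_sg ?mulVgK_sg.
Qed.

Lemma same_RT_iso (S : Type) (Q P : inverseSemigroupType)
    (f : S -> Q) (psi : {multiplicative Q -> P}) :
  injective psi -> same_RT f (psi \o f).
Proof.
move=> psi_inj; split=> [a b|a b c] /=.
  by rewrite !green_RE -!morph_sginv -!gmulfM; split=> [->//|/psi_inj].
rewrite !sub_right_translates_inv -!morph_sginv -!gmulfM.
by split=> [->//|/psi_inj].
Qed.

Theorem corollary2p10 (Q P : inverseSemigroupType) (A : pred Q)
    (S : subSemigroupType A) (phi : {multiplicative S -> P})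
    (hS : straight_left_I_order [set` A])
    (phi_inj : injective phi)
    (hphi : straight_left_I_order (range phi)) :
  isomorphic_over phi <->
  (forall a b c : S,
    (green_R_on [set` A] (val a) (val b) <->
       green_R_on (range phi) (phi a) (phi b)) /\
    (ternary_T_on [set` A] (val a) (val b) (val c) <->
       ternary_T_on (range phi) (phi a) (phi b) (phi c))).
Proof.
pose f : {multiplicative S -> Q} := val.
have fA : range f = [set` A].
  apply/seteqP; split=> [_ [a _ <-] |q Aq]; first exact: valP.
  by exists (Sub q Aq) => //; exact: SubK.
rewrite -fA in hS *; rewrite (same_RT_onE f phi).
split=> [[psi [psi_bij psiE]]|RT].
  rewrite -(_ : psi \o f = phi); first exact/same_RT_iso/bij_inj.
  exact/funext.
by apply: iso_of_same_RT RT => //; [exact: val_inj|case: hS|case: hphi].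
Qed.
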